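(* Let $T$ be a bounded linear operator on a (real or complex) Banach space $X$. Then the following are equivalent: (i) $T$ is uniformly ergodic. (ii) $\frac1n\|T^n\| \to 0$ and $D(H)= \overline{(I-T)X}$. (iii) $\frac1n\|T^n\| \to 0$ and $\sup_n \|H_n x\| < \infty$ for every $x \in \overline{(I-T)X}$. (iv) $\sup_n \|M_n(T)\| < \infty$, $\frac1n\|T^n\| \to 0$, and $D(H)$ is closed.
   Context: For a bounded linear operator $T$ on a Banach space $X$: $M_n(T):=\frac1n\sum_{k=1}^n T^k$; $T$ is uniformly ergodic if $M_n(T)$ converges in operator norm as $n\to\infty$. Put $H_nx:=\sum_{k=1}^n \frac1k T^kx$, and let $D(H)$ (the domain of the one-sided ergodic Hilbert transform $H=H_T$) be the set of $x\in X$ for which $H_Tx:=\lim_{n\to\infty}H_nx$ exists in norm. *)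

(* Defs.v *)
From mathcomp Require Import all_boot all_order all_algebra.
From mathcomp Require Import all_classical all_reals all_analysis.

Set Implicit Arguments.
Unset Strict Implicit.
Unset Printing Implicit Defensive.
Import Order.TTheory GRing.Theory Num.Theory.
Import numFieldNormedType.Exports.
Local Open Scope classical_set_scope.
Local Open Scope ring_scope.

(* Everything is stated over a numFieldType K so that it applies both to a
   realType R and to R[i].  The norm of a normed module over K takes its values
   in the nonnegative elements of K, and in R[i] the order is the partial one
   with x <= y iff y - x is a nonnegative real. *)

(* Every upper bound in R[i] of a nonempty set of reals is real, so for K = R[i]
   as well as for K = R this supremum is the usual one as soon as f is bounded
   on the unit ball; for an unbounded f it is the junk value 0. *)
Definition opnorm (K : numFieldType) (X Y : normedModType K) (f : X -> Y) : K :=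
  supremum 0 [set `|f x| | x in [set x : X | `|x| <= 1]].

Definition bounded_operator (K : numFieldType) (X Y : normedModType K)
    (f : {linear X -> Y}) : Prop :=
  bounded_near f (nbhs (0 : X)).

Section ergodic.
Variables (K : numFieldType) (X : normedModType K) (T : {linear X -> X}).

Definition ergodic_mean (n : nat) (x : X) : X :=
  n%:R^-1 *: \sum_(1 <= k < n.+1) iter k T x.

(* The limit is required to be a bounded operator, so that opnorm is only
   applied to bounded operators. *)
Definition uniformly_ergodic : Prop :=
  exists2 E : {linear X -> X}, bounded_operator E &
    (fun n => opnorm (ergodic_mean n \- E)) @ \oo --> (0 : K).

Definition powers_sublinear : Prop :=
  (fun n => n%:R^-1 * opnorm (iter n T)) @ \oo --> (0 : K).

Definition ergodic_means_bounded : Prop :=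
  has_ubound [set opnorm (ergodic_mean n) | n in [set n | (0 < n)%N]].

Definition hilbert_sum (n : nat) (x : X) : X :=
  \sum_(1 <= k < n.+1) k%:R^-1 *: iter k T x.

Definition hilbert_domain : set X :=
  [set x | cvg (hilbert_sum n x @[n --> \oo])].

Definition hilbert_sums_bounded (x : X) : Prop :=
  has_ubound [set `|hilbert_sum n x| | n in [set n | (0 < n)%N]].

Definition closure_range_1subT : set X := closure (range (fun x => x - T x)).

End ergodic.

(* Main.v *)
From HB Require Import structures.
Require Import Defs.
From mathcomp Require Import all_boot all_order all_algebra.
From mathcomp Require Import all_classical all_reals all_analysis.
From mathcomp.real_closed Require Import complex.
From mathcomp Require Import zify ring.
Import Order.TTheory GRing.Theory Num.Theory.
Import numFieldNormedType.Exports.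
Local Open Scope classical_set_scope.
Local Open Scope ring_scope.

Set Implicit Arguments.
Unset Strict Implicit.
Unset Printing Implicit Defensive.

(** Write Y for the closure of (I - T)X, M_n for the ergodic means and H_n for
    the partial sums of the Hilbert transform.

    Everything rests on one observation.  If A = a_1 T + ... + a_n T^n with
    a_1 + ... + a_n = 1, then I - A = (I - T)Q for a polynomial Q in T, because
    each I - T^k is divisible by I - T.  If moreover A has norm at most 1/2 on
    Y, then I - A is invertible on Y by the Neumann series, hence so is I - T,
    with a bounded inverse ([sub1T_invertible]).  Both M_n and the normalised
    sum H_n / h_n, where h_n = 1 + 1/2 + ... + 1/n, have this form.

    When I - T is invertible on Y, every x splits as a fixed point plus a
    vector of Y; on Y one has M_n = M_n (I - T) (I - T)^-1, and
    M_n (I - T) = (T - T^(n+1)) / n is small in norm as soon as T^n / n is.  So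
    T is uniformly ergodic ([uniformly_ergodic_of_contraction]).

    (i) => (ii).  The limit E of the means vanishes on Y, so M_n is a
    contraction on Y for large n and Y = (I - T)X.  Summing twice by parts, with
    bounded means and T^n / n -> 0, shows that H converges on (I - T)X
    ([range_subset_hilbert_domain]).  Conversely, if H_n x stays bounded then
    H_n x / h_n -> 0, since h_n is unbounded, while x - H_n x / h_n lies in
    (I - T)X; so x belongs to Y ([hilbert_sums_bounded_closure]).

    (ii) => (iii).  Convergent sequences are bounded.

    (iii) => (i).  By uniform boundedness on Y the H_n have norms at most C on
    Y, so H_n / h_n is a contraction on Y once h_n >= 2 C.

    (i) and (ii) together give (iv), as Y is closed.  In (iv), D(H) contains
    (I - T)X and is contained in Y; being closed it equals Y, which is (ii).

    The real and the complex cases are treated together, over any field of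
    numbers in which bounded nonempty sets of nonnegative elements have
    suprema. *)

(** * Scalars with suprema *)

(** This is the only completeness property of the scalars that the proof needs,
    and it makes sense for the partial order of the complex numbers, where the
    nonnegative elements are the nonnegative reals. *)
Definition bounded_suprema (K : numFieldType) : Prop :=
  forall A : set K, A !=set0 -> A `<=` [set x | 0 <= x] -> has_ubound A ->
    supremums A !=set0.

Lemma bounded_suprema_real (R : realType) : bounded_suprema R.
Proof.
move=> A A0 _ ubA; exists (sup A); split.
- exact: ub_le_sup.
- by move=> b Ab; apply: ge_sup.
Qed.

Lemma bounded_suprema_complex (R : realType) : bounded_suprema R[i].
Proof.
move=> A [a Aa] A_ge0 [b Ab].
have realA x : A x -> x = (complex.Re x)%:C%C.
  by move=> /A_ge0 /=; rewrite lecE /= => /andP[/eqP + _]; case: x => ? ? /= ->.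
pose B := @complex.Re R @` A.
have B0 : B !=set0 by exists (complex.Re a), a.
have ubB : has_ubound B.
  exists (complex.Re b) => _ [x Ax <-].
  by have := Ab x Ax; rewrite lecE => /andP[].
exists (sup B)%:C%C; split=> [x Ax|c Ac].
- rewrite (realA x Ax) lecR; apply: ub_le_sup => //; by exists x.
- have := Ac a Aa; rewrite (realA a Aa) lecE /= => /andP[Imc _].
  rewrite lecE /= Imc /=; apply: ge_sup => // _ [x Ax <-].
  by have := Ac x Ax; rewrite lecE => /andP[].
Qed.

Lemma divD1_mul_le (K : numFieldType) (e c : K) :
  0 <= e -> 0 <= c -> e / (c + 1) * c <= e.
Proof.
move=> e0 c0; rewrite mulrAC -mulrA ler_piMr//.
by rewrite ler_pdivrMr ?ltr_wpDl// mul1r lerDl.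
Qed.

Section scalars.
Variable K : numFieldType.
Hypothesis supK : bounded_suprema K.

(** A supremum s of u would satisfy s <= s - d.  The archimedean property, the
    divergence of the harmonic series and the Cauchy criterion for bounded sums
    of nonnegative terms are all instances of this lemma. *)
Lemma unbounded_of_steps (u : nat -> K) (d : K) : 0 < d ->
  (forall n, 0 <= u n) -> (forall n, exists m, u n + d <= u m) ->
  forall b, 0 <= b -> exists n, b < u n.
Proof.
move=> d0 u0 step b b0; apply: contrapT => nb.
have ub : has_ubound (range u).
  exists b => _ [n _ <-]; rewrite real_leNgt ?ger0_real//.
  by apply/negP => bn; apply: nb; exists n.
have [||s [us ls]] := supK _ _ ub.
- by exists (u 0%N), 0%N.
- by move=> _ [n _ <-] /=.
- have : s <= s - d.
    apply: ls => _ [n _ <-]; have [m nm] := step n.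
    by rewrite lerBrDr (le_trans nm)//; apply: us; exists m.
  by rewrite lerBrDr gerDl => /(lt_le_trans d0); rewrite ltxx.
Qed.

Lemma exists_nat_gt (b : K) : 0 <= b -> exists n, b < n.+1%:R.
Proof.
apply: (@unbounded_of_steps (fun n => n.+1%:R) 1) => // n.
by exists n.+1; rewrite natr1.
Qed.

Lemma exists_harmonic_gt (b : K) : 0 <= b ->
  exists n, b < \sum_(1 <= k < n.+2) k%:R^-1.
Proof.
pose h n : K := \sum_(1 <= k < n.+2) k%:R^-1.
apply: (@unbounded_of_steps h 2^-1) => [|n|n].
- by rewrite invr_gt0.
- by apply: sumr_ge0.
exists (n.+1 + n)%N; rewrite /h [leRHS](@big_cat_nat _ _ _ n.+2)//=; last first.
  by rewrite !ltnS leq_addl.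
rewrite lerD2l.
have -> : 2^-1 = \sum_(n.+2 <= k < (n.+1 + n).+2) (n.+1 + n.+1)%:R^-1 :> K.
  rewrite sumr_const_nat.
  have -> : ((n.+1 + n).+2 - n.+2 = n.+1)%N by rewrite -addSn -addnS addKn.
  by rewrite addnn -mul2n natrM invfM -[RHS]mulr_natr mulfVK// pnatr_eq0.
apply: ler_sum_nat => k /andP[k1 k2].
by rewrite lef_pV2 ?posrE ?ltr0n ?ler_nat; lia.
Qed.

Lemma cvg_invn : n%:R^-1 @[n --> \oo] --> (0 : K).
Proof.
apply/cvgrPdist_le => e e0.
have [|N eN] := @exists_nat_gt e^-1; first by rewrite invr_ge0 ltW.
near=> n; rewrite sub0r normrN ger0_norm ?invr_ge0//.
have nN : (N < n)%N by near: n; exists N.+1.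
rewrite -[leRHS]invrK lef_pV2 ?posrE ?invr_gt0// ?ltr0n ?(leq_ltn_trans _ nN)//.
by rewrite (le_trans (ltW eN))// ler_nat.
Unshelve. all: by end_near. Qed.

Lemma series_tail_small (v : nat -> K) (M : K) : (forall n, 0 <= v n) ->
  (forall n, \sum_(0 <= k < n) v k <= M) ->
  forall e, 0 < e -> exists N, forall n m, (N <= n)%N -> (n <= m)%N ->
    \sum_(n <= k < m) v k < e.
Proof.
move=> v0 vM e e0; apply: contrapT => nN.
have M0 : 0 <= M by apply: le_trans (vM 0%N); rewrite big_geq.
have [|N|n] := @unbounded_of_steps (fun n => \sum_(0 <= k < n) v k) e e0 _ _ M M0.
- by move=> n; apply: sumr_ge0.
- apply: contrapT => nm; apply: nN; exists N => n m Nn mn.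
  rewrite real_ltNge ?(gtr0_real e0) ?ger0_real ?sumr_ge0//.
  apply/negP => em; apply: nm; exists m.
  rewrite [leRHS](@big_cat_nat _ _ _ n)//= lerD//.
  by rewrite [leRHS](@big_cat_nat _ _ _ N)//= lerDl sumr_ge0.
- by move=> /lt_le_trans /(_ (vM n)); rewrite ltxx.
Qed.

End scalars.

(** * Series and closed subspaces *)

Section banach.
Variable K : numFieldType.
Hypothesis supK : bounded_suprema K.

(** Comparison with a scalar series: absolute convergence in a complete space. *)
Lemma normal_series_cvg (X : completeNormedModType K) (w : nat -> X)
    (v : nat -> K) (M : K) :
  (forall n, `|w n| <= v n) -> (forall n, \sum_(0 <= k < n) v k <= M) ->
  cvgn (series w).
Proof.
move=> wv vM; apply/cauchy_cvgP/cauchy_seriesP => e e0.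
have v0 n : 0 <= v n by apply: le_trans (wv n).
have [N tailN] := series_tail_small supK v0 vM e0.
near=> nm; apply: (@le_lt_trans _ _ (\sum_(nm.1 <= k < nm.2) v k)).
  by rewrite (le_trans (ler_norm_sum _ _ _))// ler_sum.
have [n12|n21] := leqP nm.1 nm.2; last by rewrite big_geq ?(ltnW n21).
apply: tailN => //; near: nm.
by exists ([set n | N <= n]%N, setT) => [|[n m] []]//; split; [exists N|exists 0%N].
Unshelve. all: by end_near. Qed.

Section closed_subspace.
Variable X : normedModType K.

Lemma closure_normP (S : set X) (x : X) :
  closure S x <-> forall e, 0 < e -> exists2 y, S y & `|x - y| <= e.
Proof.
split=> [Sx e e0|near_x B /nbhs_normP[e /= e0 eB]].
- have [y [Sy]] := Sx _ (nbhsx_ballx x e e0).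
  by rewrite -ball_normE /= => /ltW xy; exists y.
- have [|y Sy xy] := near_x (e / 2); first by rewrite divr_gt0.
  exists y; split=> //; apply: eB; rewrite /ball_ /=.
  by rewrite (le_lt_trans xy)// ltr_pdivrMr// ltr_pMr// ltr1n.
Qed.

Lemma norm_limit_le (u : nat -> X) (l : X) (a : X) (c : K) :
  u n @[n --> \oo] --> l -> (\forall n \near \oo, `|u n - a| <= c) ->
  `|l - a| <= c.
Proof.
move=> /cvgrPdist_le ul uac; apply/ler_addgt0Pl => e e0; near \oo => n.
rewrite -(subrKA (u n)) (le_trans (ler_normD _ _))// lerD//; near: n => //.
exact: ul.
Unshelve. all: by end_near. Qed.

Definition closed_subspace (Y : set X) : Prop :=
  [/\ closed Y, Y 0, forall x y, Y x -> Y y -> Y (x + y) &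
      forall (a : K) x, Y x -> Y (a *: x)].

Lemma closed_subspace_sum (Y : set X) (u : nat -> X) (m n : nat) :
  closed_subspace Y -> (forall k, Y (u k)) -> Y (\sum_(m <= k < n) u k).
Proof. by move=> [_ Y0 YD _] Yu; elim/big_ind: _. Qed.

Lemma closed_subspaceB (Y : set X) (x y : X) :
  closed_subspace Y -> Y x -> Y y -> Y (x - y).
Proof. by move=> [_ _ YD YZ] Yx Yy; apply: YD => //; rewrite -scaleN1r; apply: YZ. Qed.

End closed_subspace.

(** The Neumann series z = y + A y + A^2 y + ..., carried out inside a closed
    subspace, so that A need only be small there. *)
Lemma neumann (X : completeNormedModType K) (Y : set X) (A : {linear X -> X}) :
  closed_subspace Y -> continuous A -> (forall y, Y y -> Y (A y)) ->
  (forall y, Y y -> `|A y| <= 2^-1 * `|y|) ->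
  forall y, Y y -> exists z, [/\ Y z, z - A z = y & `|z| <= 2 * `|y|].
Proof.
move=> sY Acont AY A2 y Yy.
have Yw k : Y (iter k A y) by elim: k => //= k; apply: AY.
have wk k : `|iter k A y| <= 2^-1 ^+ k * `|y|.
  elim: k => [|k IH]; first by rewrite expr0 mul1r.
  by rewrite exprS -mulrA (le_trans (A2 _ (Yw k)))// ler_wpM2l ?invr_ge0.
have sumv n : \sum_(0 <= k < n) (2^-1 ^+ k * `|y|) <= 2 * `|y|.
  have -> : \sum_(0 <= k < n) (2^-1 ^+ k * `|y|) = 2 * (1 - 2^-1 ^+ n) * `|y|.
    elim: n => [|n IH]; first by rewrite big_geq// expr0 subrr mulr0 mul0r.
    by rewrite big_nat_recr//= IH exprS; field.
  by rewrite ler_wpM2r// ler_piMr// gerBl exprn_ge0// invr_ge0.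
have cs := normal_series_cvg wk sumv.
pose z := lim (series (fun k => iter k A y) @ \oo).
have sz : series (fun k => iter k A y) @ \oo --> z by [].
have Ys n : Y (series (fun k => iter k A y) n) by apply: closed_subspace_sum.
exists z; split.
- by case: sY => clY _ _ _; apply: (closed_cvg Y clY _ _ sz); apply: nearW.
- have sA : (series (fun k => iter k A y) n - A (series (fun k => iter k A y) n))
      @[n --> \oo] --> z - A z.
    by apply: cvgB => //; apply: continuous_cvg => //; apply: Acont.
  have sy : (y - iter n A y) @[n --> \oo] --> y - 0.
    by apply: cvgB; [exact: cvg_cst|exact: cvg_series_cvg_0].
  rewrite subr0 in sy; apply: (cvg_unique (@norm_hausdorff _ _) sA); apply: cvg_trans sy.
  apply: near_eq_cvg; apply: nearW => n.
  rewrite /series/= linear_sum -sumrB; elim: n => [|n IH].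
    by rewrite big_geq// subrr.
  by rewrite big_nat_recr//= -IH subrKA.
- rewrite -[z]subr0; apply: (norm_limit_le sz); near=> n; rewrite subr0.
  by rewrite (le_trans (ler_norm_sum _ _ _))// (le_trans _ (sumv n))// ler_sum.
Unshelve. all: by end_near. Qed.

End banach.

(** * Uniform boundedness and operator norms *)

Section uniform_boundedness.
Variable K : numFieldType.
Hypothesis supK : bounded_suprema K.

Lemma bounded_operatorP (X Z : normedModType K) (f : {linear X -> Z}) :
  bounded_operator f <-> exists2 c, 0 <= c & forall x, `|f x| <= c * `|x|.
Proof.
rewrite /bounded_operator linear_boundedP; split=> [/pinfty_ex_gt0[c c0 fc]|[c c0 fc]].
  by exists c => //; exact: ltW.
near=> d => x; rewrite (le_trans (fc x))// ler_wpM2r//; near: d.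
by apply: nbhs_pinfty_ge; exact: ger0_real.
Unshelve. all: by end_near. Qed.

(** If every F n were at most k + 1 on the vectors of Y within r / 2 of x, then
    translation and scaling would bound the F n uniformly on Y.  So some F n
    exceeds k + 1 at a nearby point x', hence k on a small ball around x'. *)
Lemma large_on_small_ball (X Z : normedModType K) (Y : set X)
    (F : nat -> {linear X -> Z}) :
  closed_subspace Y -> (forall n, bounded_operator (F n)) ->
  ~ (exists2 C, 0 <= C & forall n y, Y y -> `|F n y| <= C * `|y|) ->
  forall (k : nat) x r, Y x -> 0 < r -> exists (x' : X) (r' : K),
    [/\ Y x', 0 < r', `|x' - x| <= r - r' &
        exists n, forall z, `|z - x'| <= r' -> k%:R <= `|F n z|].
Proof.
move=> [_ _ YD YZ] bF unbF k x r Yx r0; apply: contrapT => small; apply: unbF.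
have r2 : 0 < r / 2 by rewrite divr_gt0.
have smallF n x' : Y x' -> `|x' - x| <= r / 2 -> `|F n x'| <= k.+1%:R.
  move=> Yx' x'x; rewrite real_leNgt ?ger0_real//; apply/negP => big.
  have /bounded_operatorP[c c0 Fc] := bF n.
  (* The radius (2 / r + c)^-1 is at most both r / 2 and c^-1: the first keeps
     the new ball inside the old one, the second makes F n vary by at most 1. *)
  have i0 : 0 < 2 / r + c by rewrite ltr_pwDl// divr_gt0.
  apply: small; exists x', (2 / r + c)^-1; split => //.
  - by rewrite invr_gt0.
  - rewrite (le_trans x'x)// lerBrDr -lerBrDl.
    have -> : r - r / 2 = (2 / r)^-1 by field; rewrite gt_eqF.
    by rewrite lef_pV2 ?posrE ?divr_gt0// lerDl.
  - exists n => z zx'.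
    have : `|F n x'| - 1 <= `|F n z|.
      rewrite lerBlDr -lerBlDl (le_trans (lerB_dist _ _))//.
      rewrite -linearB (le_trans (Fc _))// distrC.
      rewrite (le_trans (ler_wpM2l c0 zx'))//.
      by rewrite ler_pdivrMr// mul1r lerDr divr_ge0// ltW.
    by apply: le_trans; rewrite lerBrDr natr1 ltW.
exists (4 * k.+1%:R / r) => [|n y Yy].
  by rewrite divr_ge0 ?mulr_ge0// ltW.
have [->|y0] := eqVneq y 0; first by rewrite linear0 !normr0 mulr0.
have ny0 : 0 < `|y| by rewrite normr_gt0.
pose t := r / 2 / `|y|.
have t0 : 0 < t by rewrite divr_gt0.
have bFt : `|F n (t *: y)| <= 2 * k.+1%:R.
  rewrite -[t *: y](addrK x) addrC linearD linearN addrC.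
  rewrite mulrDl mul1r (le_trans (ler_normB _ _))// lerD ?smallF//.
  - by apply: YD => //; apply: YZ.
  - by rewrite addrK normrZ gtr0_norm// /t divfK// gt_eqF.
  - by rewrite subrr normr0 ltW.
rewrite linearZ normrZ gtr0_norm// -ler_pdivlMl// in bFt.
apply: le_trans bFt _; rewrite le_eqVlt; apply/orP; left; apply/eqP.
by rewrite /t; field; rewrite !gt_eqF.
Qed.

(** The nested balls argument: for each m some F n has norm at least m on
    the (m+1)-st ball, and the centres converge to a vector of Y that lies in
    all the balls. *)
Lemma uniform_boundedness (X : completeNormedModType K) (Z : normedModType K)
    (Y : set X) (F : nat -> {linear X -> Z}) :
  closed_subspace Y -> (forall n, bounded_operator (F n)) ->
  (forall y, Y y -> exists M, forall n, `|F n y| <= M) ->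
  exists2 C, 0 <= C & forall n y, Y y -> `|F n y| <= C * `|y|.
Proof.
move=> sY bF ptF; apply: contrapT => unbF.
have /choice[g gP] (p : X * K * nat) : exists q : X * K,
    Y p.1.1 -> 0 < p.1.2 -> [/\ Y q.1, 0 < q.2, `|q.1 - p.1.1| <= p.1.2 - q.2 &
        exists n, forall z, `|z - q.1| <= q.2 -> p.2%:R <= `|F n z|].
  have [[Yx r0]|/not_andP nv] := pselect (Y p.1.1 /\ 0 < p.1.2).
    have [x' [r' H]] := large_on_small_ball sY bF unbF p.2 Yx r0.
    by exists (x', r').
  by exists p.1 => Yx r0; case: nv.
pose s := fix s n := if n is n'.+1 then g (s n', n') else (0, 1) : X * K.
have sP n : Y (s n).1 /\ 0 < (s n).2.
  elim: n => [|n [Yn rn]] /=; first by split; [case: sY|exact: ltr01].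
  by have [] := gP (s n, n) Yn rn.
have stepP n := gP (s n, n) (sP n).1 (sP n).2.
pose w n := (s n.+1).1 - (s n).1.
(* Nestedness in the form |x' - x| <= r - r' telescopes, which also makes the
   centres converge. *)
have nested m n : (m <= n)%N -> `|(s n).1 - (s m).1| <= (s m).2 - (s n).2.
  move=> /subnK <-; elim: (n - m)%N => [|d IH]; first by rewrite !subrr normr0.
  have [_ _ stepd _] := stepP (d + m)%N.
  rewrite addSn -(subrKA (s (d + m)%N).1) (le_trans (ler_normD _ _))//.
  by rewrite (le_trans (lerD stepd IH))// addrC subrKA.
have [x sx] : exists x : X, (s n).1 @[n --> \oo] --> x.
  have cw : cvgn (series w).
    apply: (@normal_series_cvg _ supK _ _ (fun n => (s n).2 - (s n.+1).2) (s 0%N).2).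
      by move=> n; exact: nested.
    move=> n; rewrite (eq_bigr (fun n => - ((s n.+1).2 - (s n).2))); last first.
      by move=> i _; rewrite opprB.
    by rewrite sumrN telescope_sumr// opprB gerBl ltW//; case: (sP n).
  suff -> : (fun n => (s n).1) = series w by apply/cvg_ex.
  by apply/funext => n; rewrite /series/= telescope_sumr// subr0.
have Yx : Y x.
  case: sY => clY _ _ _; apply: (closed_cvg Y clY _ _ sx).
  by apply: nearW => n; case: (sP n).
have xs m : `|x - (s m).1| <= (s m).2.
  apply: (norm_limit_le sx); near=> n; rewrite (le_trans (nested m n _))//.
    by near: n; exists m.
  by rewrite gerBl ltW//; case: (sP n).
have [M FM] := ptF x Yx.
have M0 : 0 <= M by apply: le_trans (FM 0%N).
have [k Mk] := exists_nat_gt supK M0.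
have [_ _ _ [n Fn]] := stepP k.+1.
by have := lt_le_trans Mk (le_trans (Fn x (xs k.+2)) (FM n)); rewrite ltxx.
Unshelve. all: by end_near. Qed.

End uniform_boundedness.

Section operator_norm.
Variables (K : numFieldType) (X Z : normedModType K).
Hypothesis supK : bounded_suprema K.

(** For a bounded operator the supremum that defines [opnorm] exists, so its
    value is not the default one. *)
Lemma opnorm_supremum (f : {linear X -> Z}) (c : K) :
  0 <= c -> (forall x, `|f x| <= c * `|x|) ->
  supremums [set `|f x| | x in [set x : X | `|x| <= 1]] (opnorm f).
Proof.
move=> c0 fc; rewrite /opnorm /supremum.
have A0 : [set `|f x| | x in [set x : X | `|x| <= 1]] !=set0.
  by exists `|f 0|, 0 => //=; rewrite normr0.
case: ifPn => [/eqP A_eq0|_]; first by case: A0 => a; rewrite A_eq0.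
apply: xgetPex; apply: supK => //; first by move=> _ [x _ <-] /=.
exists c => _ [x /= x1 <-]; rewrite (le_trans (fc x))//.
by rewrite -[leRHS]mulr1 ler_wpM2l.
Qed.

Lemma opnorm_ge0 (f : {linear X -> Z}) : bounded_operator f -> 0 <= opnorm f.
Proof.
move=> /bounded_operatorP[c c0 fc]; have [ub _] := opnorm_supremum c0 fc.
by apply: (le_trans (normr_ge0 (f 0))); apply: ub; exists 0 => //=; rewrite normr0.
Qed.

Lemma opnorm_le (f : {linear X -> Z}) (c : K) :
  0 <= c -> (forall x, `|f x| <= c * `|x|) -> opnorm f <= c.
Proof.
move=> c0 fc; have [_ lub] := opnorm_supremum c0 fc.
apply: lub => _ [x /= x1 <-]; rewrite (le_trans (fc x))//.
by rewrite -[leRHS]mulr1 ler_wpM2l.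
Qed.

Lemma le_opnorm (f : {linear X -> Z}) : bounded_operator f ->
  forall x, `|f x| <= opnorm f * `|x|.
Proof.
move=> bf x; have /bounded_operatorP[c c0 fc] := bf.
have [ub _] := opnorm_supremum c0 fc.
have [->|x0] := eqVneq x 0; first by rewrite linear0 !normr0 mulr0.
have nx0 : 0 < `|x| by rewrite normr_gt0.
rewrite -ler_pdivrMr//; apply: ub; exists (`|x|^-1 *: x) => /=.
  by rewrite normrZ normfV normr_id mulVf ?gt_eqF.
by rewrite linearZ normrZ normfV normr_id mulrC.
Qed.

(** Norm convergence to 0 restated with vectors only; the weights a n allow for
    both M_n - E (a n = 1) and T^n / n (a n = 1 / n). *)
Lemma cvg_weighted_opnorm0P (a : nat -> K) (F : nat -> {linear X -> Z}) :
  (forall n, 0 <= a n) -> (forall n, bounded_operator (F n)) ->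
  (a n * opnorm (F n) @[n --> \oo] --> (0 : K)) <->
  forall e, 0 < e -> exists N, forall n, (N <= n)%N ->
    forall x, a n * `|F n x| <= e * `|x|.
Proof.
move=> a0 bF; split=> [/cvgrPdist_le aF e e0|aF].
  have [N _ aN] := aF e e0; exists N => n Nn x.
  have := aN n Nn; rewrite /= sub0r normrN ger0_norm ?mulr_ge0 ?opnorm_ge0// => aFe.
  rewrite (le_trans (ler_wpM2l (a0 n) (le_opnorm (bF n) x)))//.
  by rewrite mulrA ler_wpM2r.
apply/cvgrPdist_le => e e0; have [N aN] := aF e e0; near=> n.
rewrite sub0r normrN ger0_norm ?mulr_ge0 ?opnorm_ge0//.
have Nn : (N <= n)%N by near: n; exists N.
have := a0 n; rewrite le_eqVlt => /predU1P[<-|an0]; first by rewrite mul0r ltW.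
rewrite -ler_pdivlMl// mulrC; apply: opnorm_le; first by rewrite divr_ge0// ltW.
by move=> x; rewrite mulrAC ler_pdivlMr// mulrC aN.
Unshelve. all: by end_near. Qed.

End operator_norm.

(** * Polynomials in an operator and the invertibility of I - T *)

Lemma iter_is_linear (K : numFieldType) (X : lmodType K) (T : {linear X -> X})
  (n : nat) : linear (iter n T).
Proof. by elim: n => // n IH a x y; rewrite !iterS IH linearP. Qed.

HB.instance Definition _ (K : numFieldType) (X : lmodType K)
    (T : {linear X -> X}) (n : nat) :=
  GRing.isLinear.Build K X X *:%R (iter n T) (iter_is_linear T n).

(** Bundled as a linear map, so that means of powers, their quotients by I - T
    and the Hilbert sums are all instances of one construction. *)
Definition lin_comb (K : numFieldType) (X : lmodType K) (a : nat -> K)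
    (F : nat -> {linear X -> X}) (m n : nat) (x : X) : X :=
  \sum_(m <= k < n) a k *: F k x.

Lemma lin_comb_is_linear (K : numFieldType) (X : lmodType K) (a : nat -> K)
  (F : nat -> {linear X -> X}) (m n : nat) : linear (lin_comb a F m n).
Proof.
move=> c x y; rewrite /lin_comb scaler_sumr -big_split /=; apply: eq_bigr => k _.
by rewrite linearP scalerDr !scalerA mulrC.
Qed.

HB.instance Definition _ (K : numFieldType) (X : lmodType K) (a : nat -> K)
    (F : nat -> {linear X -> X}) (m n : nat) :=
  GRing.isLinear.Build K X X *:%R (lin_comb a F m n) (lin_comb_is_linear a F m n).

Lemma bounded_lin_comb (K : numFieldType) (X : normedModType K) (a : nat -> K)
    (F : nat -> {linear X -> X}) (m n : nat) :
  (forall k, bounded_operator (F k)) -> bounded_operator (lin_comb a F m n).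
Proof.
move=> bF; have /choice[c cP] k : exists c, 0 <= c /\ forall x, `|F k x| <= c * `|x|.
  by have /bounded_operatorP[c c0 Fc] := bF k; exists c.
apply/bounded_operatorP; exists (\sum_(m <= k < n) `|a k| * c k).
  by apply: sumr_ge0 => k _; rewrite mulr_ge0//; case: (cP k).
move=> x; rewrite /lin_comb mulr_suml (le_trans (ler_norm_sum _ _ _))//.
apply: ler_sum => k _; rewrite normrZ -mulrA ler_wpM2l//; by case: (cP k).
Qed.

Lemma bounded_iter (K : numFieldType) (X : normedModType K) (T : {linear X -> X})
  (n : nat) : bounded_operator T -> bounded_operator (iter n T).
Proof.
move=> /bounded_operatorP[c c0 Tc]; apply/bounded_operatorP.
exists (c ^+ n); first by rewrite exprn_ge0.
elim: n => [|n IH] x; first by rewrite expr0 mul1r.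
rewrite /= exprS -mulrA (le_trans (Tc _))// ler_wpM2l//; exact: IH.
Qed.

Section ergodic.
Variables (K : numFieldType) (X : completeNormedModType K) (T : {linear X -> X}).
Hypothesis supK : bounded_suprema K.
Hypothesis bT : bounded_operator T.

Local Notation Y := (closure_range_1subT T).

Definition power (k : nat) : {linear X -> X} := iter k T.

Definition power_mean (a : nat -> K) (n : nat) : {linear X -> X} :=
  lin_comb a power 1 n.+1.

Definition orbit_sum (k : nat) : {linear X -> X} := lin_comb (fun=> 1) power 0 k.

(** The quotient (I - A) / (I - T) for A = a_1 T + ... + a_n T^n with
    a_1 + ... + a_n = 1; see [sub_power_mean]. *)
Definition quotient_1subT (a : nat -> K) (n : nat) : {linear X -> X} :=
  lin_comb a orbit_sum 1 n.+1.

Lemma bounded_power k : bounded_operator (power k).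
Proof. exact: bounded_iter. Qed.

Lemma bounded_power_mean a n : bounded_operator (power_mean a n).
Proof. by apply: bounded_lin_comb => k; apply: bounded_power. Qed.

Lemma bounded_quotient_1subT a n : bounded_operator (quotient_1subT a n).
Proof.
by apply: bounded_lin_comb => k; apply: bounded_lin_comb => j; apply: bounded_power.
Qed.

Lemma lin_comb_comm a (F : nat -> {linear X -> X}) m n :
  (forall k x, F k (T x) = T (F k x)) ->
  forall x, lin_comb a F m n (T x) = T (lin_comb a F m n x).
Proof.
move=> FT x; rewrite /lin_comb linear_sum; apply: eq_bigr => k _.
by rewrite FT linearZ.
Qed.

Lemma power_comm k x : power k (T x) = T (power k x).
Proof. by rewrite /power /= -iterSr. Qed.

Lemma power_mean_comm a n x : power_mean a n (T x) = T (power_mean a n x).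
Proof. by apply: lin_comb_comm => k {}x; apply: power_comm. Qed.

Lemma quotient_1subT_comm a n x :
  quotient_1subT a n (T x) = T (quotient_1subT a n x).
Proof.
by apply: lin_comb_comm => k {}x; apply: lin_comb_comm => j {}x; apply: power_comm.
Qed.

Lemma ergodic_meanE n : ergodic_mean T n = power_mean (fun=> n%:R^-1) n.
Proof. by apply/funext => x; rewrite /ergodic_mean scaler_sumr. Qed.

(** As the weights sum to 1, I - A is the combination of the I - T^k, and
    I - T^k = (I - T)(I + T + ... + T^(k-1)). *)
Lemma sub_power_mean a n x : \sum_(1 <= k < n.+1) a k = 1 ->
  x - power_mean a n x = quotient_1subT a n x - T (quotient_1subT a n x).
Proof.
move=> a1; rewrite -[X in X - _]scale1r -a1 scaler_suml.
rewrite /power_mean /quotient_1subT /= /lin_comb (linear_sum T) -!sumrB.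
apply: eq_bigr => k _.
rewrite (linearZZ T) -!scalerBr; congr (_ *: _).
rewrite /orbit_sum /= /lin_comb (linear_sum T) -sumrB; elim: k => [|k IH].
  by rewrite big_geq// subrr.
by rewrite big_nat_recr//= -IH scale1r subrKA.
Qed.

Lemma closed_subspace_closure_range : closed_subspace Y.
Proof.
have range0 : range (fun x => x - T x) 0 by exists 0 => //; rewrite linear0 subr0.
split; first exact: closed_closure.
- exact: subset_closure.
- move=> x y /closure_normP Yx /closure_normP Yy; apply/closure_normP => e e0.
  have e2 : 0 < e / 2 by rewrite divr_gt0.
  have [_ [u _ <-] xu] := Yx _ e2; have [_ [v _ <-] yv] := Yy _ e2.
  exists ((u + v) - T (u + v)); first by exists (u + v).
  have -> : (u + v) - T (u + v) = (u - T u) + (v - T v).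
    by rewrite linearD opprD addrACA.
  by rewrite opprD addrACA [e]splitr (le_trans (ler_normD _ _))// lerD.
- move=> a x /closure_normP Yx; apply/closure_normP => e e0.
  have a1 : 0 < `|a| + 1 by rewrite ltr_pwDr.
  have [|_ [u _ <-] xu] := Yx (e / (`|a| + 1)); first by rewrite divr_gt0.
  exists (a *: u - T (a *: u)); first by exists (a *: u).
  rewrite (linearZZ T) -!scalerBr normrZ (le_trans (ler_wpM2l _ xu))//.
  by rewrite mulrC divD1_mul_le// ltW.
Qed.

Lemma closure_range_stable (f : {linear X -> X}) : bounded_operator f ->
  (forall x, f (T x) = T (f x)) -> forall y, Y y -> Y (f y).
Proof.
move=> /bounded_operatorP[c c0 fc] fT y /closure_normP Yy; apply/closure_normP => e e0.
have c1 : 0 < c + 1 by rewrite ltr_wpDl.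
have [|_ [u _ <-] yu] := Yy (e / (c + 1)); first by rewrite divr_gt0.
exists (f u - T (f u)); first by exists (f u).
rewrite -fT -!linearB (le_trans (fc _))// (le_trans (ler_wpM2l _ yu))//.
by rewrite mulrC divD1_mul_le// ltW.
Qed.

(** On Y the operator I - A is invertible and equals (I - T)Q = Q(I - T) with Q
    bounded: Q composed with the inverse of I - A inverts I - T. *)
Lemma sub1T_invertible (a : nat -> K) (n : nat) :
  \sum_(1 <= k < n.+1) a k = 1 ->
  (forall y, Y y -> `|power_mean a n y| <= 2^-1 * `|y|) ->
  (exists2 q, 0 <= q & forall y, Y y ->
     exists w, [/\ Y w, w - T w = y & `|w| <= q * `|y|]) /\
  (forall w, Y w -> w - T w = 0 -> w = 0).
Proof.
move=> a1 A2; have sY := closed_subspace_closure_range.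
have /bounded_operatorP[q q0 Qq] := bounded_quotient_1subT a n.
split=> [|w Yw w0].
  exists (q * 2) => [|y Yy]; first by rewrite mulr_ge0.
  have Acont : continuous (power_mean a n).
    exact/linear_bounded_continuous/bounded_power_mean.
  have AY : forall y, Y y -> Y (power_mean a n y).
    by apply: closure_range_stable; [exact: bounded_power_mean|exact: power_mean_comm].
  have [z [Yz zy zle]] := neumann supK sY Acont AY A2 Yy.
  exists (quotient_1subT a n z); split.
  - by apply: closure_range_stable => //; [exact: bounded_quotient_1subT|
      exact: quotient_1subT_comm].
  - by rewrite -sub_power_mean.
  - by rewrite (le_trans (Qq _))// -mulrA ler_wpM2l.
have : w - power_mean a n w = 0.
  by rewrite sub_power_mean// -quotient_1subT_comm -linearB w0 linear0.
move=> /eqP; rewrite subr_eq0 => /eqP wA; have := A2 w Yw; rewrite -wA.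
rewrite ler_pdivlMl// mulrDl mul1r gerDl => w_le0.
by apply/eqP; rewrite -normr_le0.
Qed.

Lemma power_mean_coboundary n v :
  power_mean (fun=> n%:R^-1) n (v - T v) = n%:R^-1 *: (T v - power n (T v)).
Proof.
rewrite /power_mean/= /lin_comb -scaler_sumr; congr (_ *: _).
elim: n => [|n IH]; first by rewrite big_geq// subrr.
rewrite big_nat_recr//= IH linearB /power /= -!iterSr.
by rewrite linearB subrKA.
Qed.

Lemma powers_sublinearP : powers_sublinear T <->
  forall e, 0 < e -> exists N, forall n, (N <= n)%N ->
    forall x, n%:R^-1 * `|power n x| <= e * `|x|.
Proof.
apply: (cvg_weighted_opnorm0P supK (F := power)) => n; last exact: bounded_power.
by rewrite invr_ge0.
Qed.

Lemma small_invn (e : K) : 0 < e -> exists N, forall n, (N <= n)%N -> n%:R^-1 <= e.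
Proof.
move=> e0; have /cvgrPdist_le/(_ _ e0)[N _ Ne] := cvg_invn supK.
by exists N => n /Ne /=; rewrite sub0r normrN ger0_norm// invr_ge0.
Qed.

(** M_n (I - T) = (T - T^(n+1)) / n is small in operator norm because T^n / n is. *)
Lemma small_mean_coboundary : powers_sublinear T ->
  forall e, 0 < e -> exists N, forall n, (N <= n)%N ->
    forall v, `|power_mean (fun=> n%:R^-1) n (v - T v)| <= e * `|v|.
Proof.
move=> /powers_sublinearP subl e e0.
have /bounded_operatorP[t t0 Tt] := bT.
have t1 : 0 < t + 1 by rewrite ltr_wpDl.
pose d := e / 2 / (t + 1); have d0 : 0 < d by rewrite !divr_gt0.
have [N1 Nd] := small_invn d0; have [N2 Ns] := subl d d0.
exists (maxn N1 N2) => n; rewrite geq_max => /andP[n1 n2] v.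
rewrite power_mean_coboundary scalerBr (le_trans (ler_normB _ _))//.
rewrite !normrZ ger0_norm ?invr_ge0//.
apply: (@le_trans _ _ (d * `|T v| + d * `|T v|)).
  by rewrite lerD ?Ns// ler_wpM2r ?Nd.
rewrite -mulr2n -[leLHS]mulr_natl (le_trans (ler_wpM2l _ (ler_wpM2l (ltW d0) (Tt v))))//.
rewrite !mulrA ler_wpM2r//.
have -> : 2 * e / 2 / (t + 1) * t = e / (t + 1) * t by field; rewrite gt_eqF.
by rewrite divD1_mul_le// ltW.
Qed.

Lemma mean_fixed n x : T x = x -> power_mean (fun=> n.+1%:R^-1) n.+1 x = x.
Proof.
move=> Tx; rewrite /power_mean/= /lin_comb -scaler_sumr.
have -> : \sum_(1 <= k < n.+2) power k x = \sum_(1 <= k < n.+2) x.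
  by apply: eq_bigr => k _; rewrite /power /=; elim: k => //= k ->.
by rewrite sumr_const_nat subn1 /= -[x *+ _]scaler_nat scalerA mulVf ?scale1r// pnatr_eq0.
Qed.

Lemma uniformly_ergodicP : uniformly_ergodic T <->
  exists2 E : {linear X -> X}, bounded_operator E &
    forall e, 0 < e -> exists N, forall n, (N <= n)%N ->
      forall x, `|power_mean (fun=> n%:R^-1) n x - E x| <= e * `|x|.
Proof.
have key (E : {linear X -> X}) (bE : bounded_operator E) :
    opnorm (ergodic_mean T n \- E) @[n --> \oo] --> (0 : K) <->
    forall e, 0 < e -> exists N, forall n, (N <= n)%N ->
      forall x, `|power_mean (fun=> n%:R^-1) n x - E x| <= e * `|x|.
  pose F n : {linear X -> X} := power_mean (fun=> n%:R^-1) n \- E.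
  have bF n : bounded_operator (F n).
    have /bounded_operatorP[c c0 Ec] := bE.
    have /bounded_operatorP[d d0 Md] := bounded_power_mean (fun=> n%:R^-1) n.
    apply/bounded_operatorP; exists (d + c) => [|x]; first by rewrite addr_ge0.
    by rewrite mulrDl (le_trans (ler_normB _ _) (lerD (Md x) (Ec x))).
  have -> : (fun n => opnorm (ergodic_mean T n \- E)) = (fun n => 1 * opnorm (F n)).
    by apply/funext => n; rewrite mul1r ergodic_meanE.
  rewrite (cvg_weighted_opnorm0P supK (a := fun=> 1))//.
  split=> H e /H [N HN]; exists N => n /HN {}HN x; have := HN x; by rewrite mul1r.
by split=> -[E bE ME]; exists E => //; apply/key.
Qed.

(** P x is the vector of Y with (I - T) P x = (I - T) x; it is unique, hence
    linear in x.  The limit of the means is E = I - P, the projection on the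
    fixed points along Y. *)
Lemma uniformly_ergodic_of_contraction (a : nat -> K) (n : nat) :
  \sum_(1 <= k < n.+1) a k = 1 ->
  (forall y, Y y -> `|power_mean a n y| <= 2^-1 * `|y|) ->
  powers_sublinear T -> uniformly_ergodic T.
Proof.
move=> a1 A2 subl; have [[q q0 inv] inj] := sub1T_invertible a1 A2.
have sY := closed_subspace_closure_range.
have /bounded_operatorP[t t0 Tt] := bT.
have /choice[P PP] x : exists w, [/\ Y w, w - T w = x - T x &
    `|w| <= q * (1 + t) * `|x|].
  have [|w [Yw wx wq]] := inv (x - T x).
    by apply: subset_closure; exists x.
  exists w; split=> //; rewrite (le_trans wq)// -mulrA ler_wpM2l//.
  by rewrite mulrDl mul1r (le_trans (ler_normB _ _))// lerD2l.
have PY x : Y (P x) by case: (PP x).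
have PT x : P x - T (P x) = x - T x by case: (PP x).
have Pc x : `|P x| <= q * (1 + t) * `|x| by case: (PP x).
have Plin : linear P.
  move=> b x y; apply/eqP; rewrite -subr_eq0; apply/eqP; apply: inj.
    case: (sY) => _ _ YD YZ.
    exact: closed_subspaceB sY (PY _) (YD _ _ (YZ b _ (PY x)) (PY y)).
  pose D : {linear X -> X} := idfun \- T.
  have DP u : D (P u) = D u := PT u.
  change (D (P (b *: x + y) - (b *: P x + P y)) = 0).
  by rewrite linearB linearP !DP linearP subrr.
pose mP := GRing.isLinear.Build K X X *:%R P Plin.
pose P' : {linear X -> X} := HB.pack P mP.
pose E : {linear X -> X} := idfun \- P'.
have EE x : E x = x - P x by [].
have c0 : 0 <= q * (1 + t) by rewrite mulr_ge0// addr_ge0.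
apply/uniformly_ergodicP; exists E.
  apply/bounded_operatorP; exists (1 + q * (1 + t)) => [|x]; first by rewrite addr_ge0.
  by rewrite EE mulrDl mul1r (le_trans (ler_normB _ _))// lerD2l.
move=> e e0; pose d := q * (q * (1 + t)); have d1 : 0 < d + 1.
  by rewrite ltr_wpDl// mulr_ge0.
have [|N smallN] := small_mean_coboundary subl (e := e / (d + 1)).
  by rewrite divr_gt0.
exists N.+1 => -[//|m] Nm x.
(* E x is a fixed point, so that M_n - E = M_n P. *)
have -> : power_mean (fun=> m.+1%:R^-1) m.+1 x - E x =
    power_mean (fun=> m.+1%:R^-1) m.+1 (P x).
  have Ex : T (E x) = E x.
    by rewrite EE linearB -[T x](subKr x) -(PT x) opprB addrA addrAC addrK.
  by rewrite -{1}(mean_fixed m Ex) -linearB EE opprB addrC subrK.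
have [v [Yv vP vq]] := inv (P x) (PY x).
rewrite -vP (le_trans (smallN _ (ltnW Nm) v))//.
apply: (@le_trans _ _ (e / (d + 1) * (d * `|x|))).
  rewrite ler_wpM2l ?divr_ge0 ?(ltW e0) ?(ltW d1)//.
  by rewrite (le_trans vq)// /d -[leRHS]mulrA ler_wpM2l.
by rewrite mulrA ler_wpM2r// divD1_mul_le ?(ltW e0)// /d !mulr_ge0 ?addr_ge0.
Qed.

End ergodic.

(** * The one-sided ergodic Hilbert transform *)

Section ergodic_hilbert.
Variables (K : numFieldType) (X : completeNormedModType K) (T : {linear X -> X}).
Hypothesis supK : bounded_suprema K.
Hypothesis bT : bounded_operator T.

Local Notation Y := (closure_range_1subT T).
Local Notation mean n := (power_mean T (fun=> n%:R^-1) n).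
Local Notation partial_sum n x := (\sum_(1 <= k < n.+1) power T k x).

Lemma ergodic_means_boundedP : ergodic_means_bounded T <->
  exists2 C, 0 <= C & forall n x, `|mean n x| <= C * `|x|.
Proof.
split=> [[C ubC]|[C C0 MC]].
  have C0 : 0 <= C.
    apply: (@le_trans _ _ (opnorm (ergodic_mean T 1))); last by apply: ubC; exists 1%N.
    by rewrite ergodic_meanE; apply/opnorm_ge0/bounded_power_mean.
  exists C => // -[|n] x.
    by rewrite /power_mean/= /lin_comb big_geq// normr0 mulr_ge0.
  apply: (le_trans (le_opnorm supK (bounded_power_mean bT _ _) x)).
  by rewrite ler_wpM2r// -ergodic_meanE; apply: ubC; exists n.+1.
exists C => _ [n _ <-]; rewrite ergodic_meanE.
by apply: opnorm_le.
Qed.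

Lemma eq0_of_small (x : X) (c : K) : 0 <= c ->
  (forall e, 0 < e -> `|x| <= e * c) -> x = 0.
Proof.
move=> c0 xe; apply/eqP; rewrite -normr_le0.
apply/ler_addgt0Pr => e e0; rewrite add0r.
have c1 : 0 < c + 1 by rewrite ltr_wpDl.
apply: (le_trans (xe (e / (c + 1)) _)); first by rewrite divr_gt0.
by rewrite divD1_mul_le// ltW.
Qed.

Lemma cvg0_of_small (u : nat -> X) (c : K) : 0 <= c ->
  (forall e, 0 < e -> exists N, forall n, (N <= n)%N -> `|u n| <= e * c) ->
  u n @[n --> \oo] --> (0 : X).
Proof.
move=> c0 uc; apply/cvgrPdist_le => e e0.
have c1 : 0 < c + 1 by rewrite ltr_wpDl.
have [|N uN] := uc (e / (c + 1)); first by rewrite divr_gt0.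
exists N => // n /uN un /=; rewrite sub0r normrN (le_trans un)//.
by rewrite divD1_mul_le// ltW.
Qed.

Lemma mean_partial_sum n x : n%:R *: mean n x = partial_sum n x.
Proof.
rewrite /power_mean/= /lin_comb -scaler_sumr scalerA.
case: n => [|n]; first by rewrite big_geq// scaler0.
by rewrite mulfV ?scale1r// pnatr_eq0.
Qed.

Section ergodic_limit.
Variable E : {linear X -> X}.
Hypothesis bE : bounded_operator E.
Hypothesis meanE : forall e, 0 < e -> exists N, forall n, (N <= n)%N ->
  forall x, `|mean n x - E x| <= e * `|x|.

(** T^(n+1) = (n+1) M_(n+1) - n M_n, where both means are close to E. *)
Lemma limit_powers_sublinear : powers_sublinear T.
Proof.
have /bounded_operatorP[c c0 Ec] := bE.
apply/(powers_sublinearP supK bT) => e e0.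
have e3 : 0 < e / 3 by rewrite divr_gt0.
have [N1 ME] := meanE e3.
have [|N2 sm] := small_invn supK (e := e / 3 / (c + 1)).
  by rewrite divr_gt0// ltr_wpDl.
exists (maxn N1 N2).+1 => -[//|n]; rewrite ltnS geq_max => /andP[n1 n2] x.
have -> : power T n.+1 x =
    n.+1%:R *: (mean n.+1 x - E x) - n%:R *: (mean n x - E x) + E x.
  rewrite !scalerBr !mean_partial_sum big_nat_recr//=.
  rewrite -natr1 scalerDl scale1r opprB -addrA [_ - _ + E x]addrAC subrKA.
  by rewrite addrAC subrr add0r.
rewrite ler_pdivrMl// (le_trans (ler_normD _ _))//.
have -> : n.+1%:R * (e * `|x|) = n.+1%:R * (e / 3 * `|x|) + n.+1%:R * (e / 3 * `|x|) +
   n.+1%:R * (e / 3 * `|x|) by field.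
rewrite lerD//.
  rewrite (le_trans (ler_normB _ _))// lerD// normrZ ger0_norm//.
    by rewrite ler_wpM2l// ME// leqW.
  by rewrite (le_trans (ler_wpM2l _ (ME n n1 x)))//
    ler_wpM2r ?mulr_ge0 ?(ltW e0) ?ler_nat.
rewrite (le_trans (Ec x))// mulrA ler_wpM2r//.
have := sm n.+1 (leqW n2); rewrite ler_pdivlMr ?ltr_wpDl// ler_pdivrMl//.
by apply: le_trans; rewrite lerDl.
Qed.

Lemma limit_means_bounded : ergodic_means_bounded T.
Proof.
have /bounded_operatorP[c c0 Ec] := bE.
have [N MN] := meanE ltr01.
have /choice[b bP] n : exists b, 0 <= b /\ forall x, `|mean n x| <= b * `|x|.
  have /bounded_operatorP[b b0 Mb] := bounded_power_mean bT (fun=> n%:R^-1) n.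
  by exists b.
have b0 n : 0 <= b n by case: (bP n).
apply/ergodic_means_boundedP; exists (1 + c + \sum_(n < N) b n).
  by rewrite addr_ge0 ?addr_ge0 ?sumr_ge0.
move=> n x; have [Nn|nN] := leqP N n.
  rewrite -(subrK (E x) (mean n x)) (le_trans (ler_normD _ _))//.
  rewrite (le_trans (lerD (MN n Nn x) (Ec x)))// -mulrDl ler_wpM2r// lerDl.
  by rewrite sumr_ge0.
have [_ /(_ x) /le_trans] := bP n; apply; rewrite ler_wpM2r//.
rewrite (bigD1 (Ordinal nN))//= addrCA lerDl addr_ge0 ?addr_ge0//.
by rewrite sumr_ge0.
Qed.

(** E (I - T) is the limit of M_n (I - T), hence zero. *)
Lemma limit_closure_range0 y : Y y -> E y = 0.
Proof.
move=> Yy; have /bounded_operatorP[c c0 Ec] := bE.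
have E0 v : E (v - T v) = 0.
  apply: (@eq0_of_small _ (`|v - T v| + `|v|)) => [|e e0]; first exact: addr_ge0.
  have [N1 ME] := meanE e0.
  have [N2 sm] := small_mean_coboundary supK bT limit_powers_sublinear e0.
  pose n := maxn N1 N2.
  rewrite -[E _](subKr (mean n (v - T v))) (le_trans (ler_normB _ _))//.
  by rewrite addrC mulrDr lerD// ?ME ?sm// /n ?leq_maxl ?leq_maxr.
apply: (@eq0_of_small _ c) => // e e0.
have [_ [v _ <-] yv] := (closure_normP _ _).1 Yy e e0.
by rewrite -[E y]subr0 -(E0 v) -linearB (le_trans (Ec _))// mulrC ler_wpM2r.
Qed.

(** Since E vanishes on Y, some M_n has norm at most 1/2 on Y. *)
Lemma closure_range_subset : Y `<=` range (fun x => x - T x).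
Proof.
have [|N MN] := meanE (e := 2^-1); first by rewrite invr_gt0.
have := sub1T_invertible supK bT (a := fun=> N.+1%:R^-1) (n := N.+1).
move=> inv1T y Yy; have [| |[q q0 inv] _] := inv1T.
- by rewrite sumr_const_nat subn1 /= -[LHS]mulr_natl mulfV// pnatr_eq0.
- by move=> z Yz; rewrite -[power_mean _ _ _ _]subr0 -(limit_closure_range0 Yz) MN.
by have [w [_ wy _]] := inv y Yy; exists w.
Qed.

End ergodic_limit.

(** Two summations by parts, the first moving I - T onto the weights 1 / k and
    the second replacing the powers by their partial sums. The weights of these
    are of order 1 / k^3.  The index is shifted by 2 to avoid the singular
    terms. *)
Lemma hilbert_sum_coboundary y n :
  hilbert_sum T n.+2 (y - T y) =
    T y + 2^-1 *: T y - n.+2%:R^-1 *: power T n.+3 y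
    - (n.+1%:R * n.+2%:R)^-1 *: partial_sum n.+2 y
    - \sum_(0 <= j < n) (2 / (j.+1%:R * j.+2%:R * j.+3%:R)) *: partial_sum j.+2 y.
Proof.
have iterB k : iter k T (y - T y) = power T k y - power T k.+1 y.
  by rewrite (linearB (power T k)) /power /= -iterSr.
elim: n => [|n IH].
  rewrite /hilbert_sum !(big_nat_recr 2)// !big_nat1 big_geq// subr0 !iterB.
  rewrite -[T y]/(power T 1 y).
  move: (power T 1 y) (power T 2 y) (power T 3 y) => u v w /=.
  (* Halving the middle power leaves only cancelling pairs on both sides. *)
  have halves : v = 2^-1 *: v + 2^-1 *: v.
    by rewrite -scalerDl -[LHS]scale1r; congr (_ *: _); field.
  rewrite invr1 scale1r mul1r {1}halves !scalerBr scalerDr !opprD !addrA.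
  by rewrite [LHS](ACl (1*2*5*4*3)) /= addrK [RHS](ACl (1*5*3*2*4)) /= addrK.
have -> : hilbert_sum T n.+3 (y - T y) =
    hilbert_sum T n.+2 (y - T y) + n.+3%:R^-1 *: (power T n.+3 y - power T n.+4 y).
  by rewrite /hilbert_sum big_nat_recr// (iterB n.+3).
rewrite IH [\sum_(0 <= j < n.+1) _]big_nat_recr// [\sum_(1 <= k < n.+4) _]big_nat_recr//.
move: (power T n.+3 y) (power T n.+4 y) => u v /=.
set S := \sum_(1 <= k < n.+3) _; set W := \sum_(0 <= k < n) _.
(* Both weights are written with their values at n + 1, so that the induction step
   is an identity between the same few vectors. *)
have -> : n.+2%:R^-1 = n.+3%:R^-1 + (n.+2%:R * n.+3%:R)^-1 :> K.
  by field; rewrite -!natrD !pnatr_eq0.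
have -> : (n.+1%:R * n.+2%:R)^-1 =
    (n.+2%:R * n.+3%:R)^-1 + 2 / (n.+1%:R * n.+2%:R * n.+3%:R) :> K.
  by field; rewrite -!natrD nat1r !pnatr_eq0.
rewrite !scalerDl !scalerBr scalerDr !opprD !addrA.
by rewrite [LHS](ACl (1*2*9*5*4*7*6*8*3)) /= addrK.
Qed.

(** In [hilbert_sum_coboundary] bounded means make the last series absolutely
    convergent, with terms dominated by a telescoping series in 1 / (j + 1), and
    T^n / n -> 0 disposes of the boundary term. *)
Lemma range_subset_hilbert_domain : powers_sublinear T -> ergodic_means_bounded T ->
  range (fun x => x - T x) `<=` hilbert_domain T.
Proof.
move=> subl /ergodic_means_boundedP[C C0 MC] _ [y _ <-].
have sumC n : `|partial_sum n y| <= n%:R * (C * `|y|).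
  by rewrite -mean_partial_sum normrZ ger0_norm// ler_wpM2l.
pose w j := (2 / (j.+1%:R * j.+2%:R * j.+3%:R)) *: partial_sum j.+2 y.
have cw : cvgn (series w).
  apply: (@normal_series_cvg _ supK _ _
    (fun j => 2 * (C * `|y|) * (j.+1%:R^-1 - j.+2%:R^-1)) (2 * (C * `|y|))).
    move=> j; rewrite normrZ ger0_norm ?divr_ge0// ?mulr_ge0//.
    rewrite (le_trans (ler_wpM2l _ (sumC j.+2)))// ?divr_ge0// ?mulr_ge0//.
    have -> : 2 / (j.+1%:R * j.+2%:R * j.+3%:R) * (j.+2%:R * (C * `|y|)) =
        2 * (C * `|y|) * (j.+1%:R * j.+3%:R)^-1.
      by field; rewrite -!natrD nat1r !pnatr_eq0.
    rewrite ler_wpM2l ?mulr_ge0//.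
    have -> : j.+1%:R^-1 - j.+2%:R^-1 = (j.+1%:R * j.+2%:R)^-1 :> K.
      by field; rewrite -natrD nat1r !pnatr_eq0.
    by rewrite lef_pV2 ?posrE ?mulr_gt0// ler_wpM2l// ler_nat.
  move=> n; rewrite -mulr_sumr ler_piMr ?mulr_ge0//.
  suff -> : \sum_(0 <= j < n) (j.+1%:R^-1 - j.+2%:R^-1) = 1 - n.+1%:R^-1 :> K.
    by rewrite gerBl.
  elim: n => [|n IH]; first by rewrite big_geq// invr1 subrr.
  by rewrite big_nat_recr//= IH subrKA.
rewrite /hilbert_domain/=.
have cH : cvgn (fun n => hilbert_sum T n.+2 (y - T y)).
  under eq_fun do rewrite hilbert_sum_coboundary.
  apply: is_cvgB => //; apply: is_cvgB; first apply: is_cvgB; first exact: is_cvg_cst.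
  - apply/cvg_ex; exists 0; apply: (@cvg0_of_small _ `|T y|) => // e e0.
    have [N sm] := (powers_sublinearP supK bT).1 subl e e0.
    exists N => n Nn; rewrite normrZ ger0_norm//.
    have -> : power T n.+3 y = power T n.+2 (T y) by rewrite /power /= -iterSr.
    by apply: sm; rewrite leqW// leqW.
  - apply/cvg_ex; exists 0; apply: (@cvg0_of_small _ (C * `|y|)) => [|e e0].
      by rewrite mulr_ge0.
    have [N sm] := small_invn supK e0; exists N => n Nn.
    rewrite normrZ ger0_norm ?invr_ge0 ?mulr_ge0//.
    rewrite (le_trans (ler_wpM2l _ (sumC n.+2)))// ?invr_ge0 ?mulr_ge0//.
    rewrite [leLHS]mulrA ler_wpM2r ?mulr_ge0// invfM mulfVK ?pnatr_eq0//.
    by apply: sm; rewrite leqW.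
have [l Hl] := (cvg_ex _).1 cH; apply/cvg_ex; exists l.
by rewrite -(cvg_shiftn 2); under eq_fun do rewrite addn2.
Qed.

(** H_n / h_n is a weighted mean of powers of T, and the harmonic numbers h_n
    are unbounded: a bound C on the Hilbert sums makes it arbitrarily small. *)
Lemma small_normalized_hilbert_sum (C e : K) : 0 <= C -> 0 < e ->
  exists n a, \sum_(1 <= k < n.+2) a k = 1 /\
    forall x c, 0 <= c -> `|hilbert_sum T n.+1 x| <= C * c ->
      `|power_mean T a n.+1 x| <= e * c.
Proof.
move=> C0 e0; have [n hn] := @exists_harmonic_gt _ supK (C / e) (divr_ge0 C0 (ltW e0)).
pose h : K := \sum_(1 <= k < n.+2) k%:R^-1.
have h0 : 0 < h by apply: le_lt_trans hn; rewrite divr_ge0// ltW.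
exists n, (fun k => k%:R^-1 / h); split=> [|x c c0 Hx].
  by rewrite -mulr_suml divff// gt_eqF.
have -> : power_mean T (fun k => k%:R^-1 / h) n.+1 x = h^-1 *: hilbert_sum T n.+1 x.
  by rewrite /hilbert_sum scaler_sumr; apply: eq_bigr => k _; rewrite scalerA mulrC.
rewrite normrZ ger0_norm ?invr_ge0 ?(ltW h0)// ler_pdivrMl// (le_trans Hx)//.
by rewrite mulrA ler_wpM2r// -ler_pdivrMr// ltW.
Qed.

(** If H_n x is bounded, then x - H_n x / h_n are elements of (I - T)X that
    converge to x. *)
Lemma hilbert_sums_bounded_closure x : hilbert_sums_bounded T x -> Y x.
Proof.
move=> [C ubC]; have C0 : 0 <= C.
  by apply: (le_trans (normr_ge0 (hilbert_sum T 1 x))); apply: ubC; exists 1%N.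
apply/closure_normP => e e0.
have [n [a [a1 small]]] := small_normalized_hilbert_sum C0 e0.
exists (x - power_mean T a n.+1 x).
  by rewrite sub_power_mean//; eexists.
rewrite subKr -[e]mulr1; apply: small => //; rewrite mulr1.
by apply: ubC; exists n.+1.
Qed.

Lemma hilbert_domain_bounded x : hilbert_domain T x -> hilbert_sums_bounded T x.
Proof.
move=> /cvg_seq_bounded/pinfty_ex_gt0[M M0 HM].
by exists M => _ [n _ <-]; apply: HM.
Qed.

Lemma hilbert_domain_subset : hilbert_domain T `<=` Y.
Proof. by move=> x /hilbert_domain_bounded; exact: hilbert_sums_bounded_closure. Qed.

Lemma uniformly_ergodic_hilbert_domain : uniformly_ergodic T ->
  [/\ powers_sublinear T, ergodic_means_bounded T & hilbert_domain T = Y].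
Proof.
move=> /(uniformly_ergodicP supK bT)[E bE ME].
have subl := limit_powers_sublinear bE ME.
have mb := limit_means_bounded bE ME.
split=> //; apply/seteqP; split; first exact: hilbert_domain_subset.
exact: subset_trans (closure_range_subset bE ME) (range_subset_hilbert_domain subl mb).
Qed.

(** Uniform boundedness on Y, which is complete, turns the pointwise bounds into
    a bound on the norms of the H_n on Y. *)
Lemma uniformly_ergodic_of_hilbert_bounded : powers_sublinear T ->
  (forall x, Y x -> hilbert_sums_bounded T x) -> uniformly_ergodic T.
Proof.
move=> subl HB; have sY := closed_subspace_closure_range T.
pose H n := power_mean T (fun k => k%:R^-1) n.
have [n|y Yy|C C0 HC] := @uniform_boundedness _ supK X X Y H sY.
- exact: bounded_power_mean.
- have [M ubM] := HB y Yy; exists M => -[|n]; last by apply: ubM; exists n.+1.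
  have M0 : 0 <= M by apply: (le_trans (normr_ge0 (H 1%N y))); apply: ubM; exists 1%N.
  by rewrite /H /power_mean/= /lin_comb big_geq// normr0.
have [|n [a [a1 small]]] := small_normalized_hilbert_sum C0 (e := 2^-1).
  by rewrite invr_gt0.
apply: (uniformly_ergodic_of_contraction supK bT a1 _ subl) => y Yy.
by apply: small => //; apply: (HC n.+1).
Qed.

Theorem uniformly_ergodic_tfae :
  [<-> uniformly_ergodic T;
       powers_sublinear T /\ hilbert_domain T = Y;
       powers_sublinear T /\ (forall x, Y x -> hilbert_sums_bounded T x);
       [/\ ergodic_means_bounded T, powers_sublinear T & closed (hilbert_domain T)]].
Proof.
have iii_i : powers_sublinear T /\ (forall x, Y x -> hilbert_sums_bounded T x) ->
    uniformly_ergodic T by case; exact: uniformly_ergodic_of_hilbert_bounded.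
have ii_iii : powers_sublinear T /\ hilbert_domain T = Y ->
    powers_sublinear T /\ (forall x, Y x -> hilbert_sums_bounded T x).
  by move=> [subl DY]; split=> // x; rewrite -DY; exact: hilbert_domain_bounded.
tfae => //.
- by move=> /uniformly_ergodic_hilbert_domain[].
- move=> /iii_i /uniformly_ergodic_hilbert_domain[subl mb ->]; split=> //.
  exact: closed_closure.
- move=> [mb subl clD]; apply/iii_i/ii_iii; split=> //.
  apply/seteqP; split; first exact: hilbert_domain_subset.
  rewrite {1}/closure_range_1subT closureE; apply: smallest_sub => //.
  exact: range_subset_hilbert_domain.
Qed.

End ergodic_hilbert.

Theorem theorem2p5 (R : realType) :
  (forall (X : completeNormedModType R) (T : {linear X -> X}),
     bounded_operator T ->
     [<-> uniformly_ergodic T;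
          powers_sublinear T /\ hilbert_domain T = closure_range_1subT T;
          powers_sublinear T /\
            (forall x, closure_range_1subT T x -> hilbert_sums_bounded T x);
          [/\ ergodic_means_bounded T, powers_sublinear T
            & closed (hilbert_domain T)]]) /\
  (forall (X : completeNormedModType R[i]) (T : {linear X -> X}),
     bounded_operator T ->
     [<-> uniformly_ergodic T;
          powers_sublinear T /\ hilbert_domain T = closure_range_1subT T;
          powers_sublinear T /\
            (forall x, closure_range_1subT T x -> hilbert_sums_bounded T x);
          [/\ ergodic_means_bounded T, powers_sublinear T
            & closed (hilbert_domain T)]]).
Proof.
split=> X T bT; apply: uniformly_ergodic_tfae => //.
- exact: bounded_suprema_real.
- exact: bounded_suprema_complex.
Qed.
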